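(* Suppose $f$ is twice differentiable with $0\preceq\nabla^2f(x)\preceq LI$ for all $x\in\mathbb{R}^{np}$, where $0<L<\infty$. Consider the asynchronous D-BFGS method started at $x(0)=x_0$, and suppose that the curvature condition and the partial asynchronicity condition with some $0<B<\infty$ hold. Then there exists a stepsize $\epsilon(t)>0$ such that $\lim_{t\to\infty}g(t)=0$, where $g(t)=\nabla f(x(t))$.
   Context: Setting. $\mathcal{G}=(\mathcal{V},\mathcal{E})$ is an undirected graph with nodes $\mathcal{V}=\{1,\dots,n\}$; $n_i=\{i\}\cup\{j:(i,j)\in\mathcal{E}\}$ and $m_i=|n_i|$. A vector $z\in\mathbb{R}^{np}$ is split in blocks $z_1,\dots,z_n\in\mathbb{R}^p$; $z_{n_i}\in\mathbb{R}^{m_ip}$ is the concatenation of the blocks $z_j$, $j\in n_i$. For $u\in\mathbb{R}^{m_ip}$ indexed by $n_i$, $\hat u\in\mathbb{R}^{np}$ is $u$ padded with zeros at nodes not in $n_i$. For $A\in\mathbb{R}^{np\times np}$, $A_{n_i}$ is the submatrix of rows and columns belonging to nodes in $n_i$. The function $f:\mathbb{R}^{np}\to\mathbb{R}$ is such that the block gradient $\nabla_i f(x)=\partial f(x)/\partial x_i$ depends only on $x_{n_i}$, for every $i$, and $f$ has a minimizer $x^*$. $D\in\mathbb{R}^{np\times np}$ is block diagonal with $i$th block $m_i^{-1}I_p$. Asynchrony. For each node $i$, $T^i$ is a set of nonnegative integer times at which $i$ is available. $\pi^i(t)=\max\{\hat t:\hat t<t,\ \hat t\in T^i\}$ (convention: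 $0$ if this set is empty) and $\pi^i_j(t)=\pi^j(\pi^i(t))$. Partial asynchronicity condition with bound $B$: for all $i,j,t$, $\max\{0,t-B+1\}\le\pi^i_j(t)\le t$. Asynchronous D-BFGS (global form). Parameters $\gamma,\Gamma>0$, stepsizes $\epsilon(t)>0$, initial $x(0)\in\mathbb{R}^{np}$, symmetric $B^k(0)\in\mathbb{R}^{m_kp\times m_kp}$ with $B^k(0)\succeq\gamma I$. For each node $k$ and $j\in n_k$ put $x^k_j(t)=x_j(\pi^k_j(t))$, $g^k_j(t)=\nabla_jf(x(\pi^k_j(t)))$, and let $x^k_{n_k}(t),g^k_{n_k}(t)$ be their concatenations over $j\in n_k$. The iteration is $$x(t+1)=x(t)+\epsilon(t)d(t),\quad d(t)=\sum_{k:\,t\in T^k}\hat e^k_{n_k}(t),\quad e^k_{n_k}(t)=-\big(B^k(t)^{-1}+\Gamma D_{n_k}\big)g^k_{n_k}(t).$$ With $$\tilde v^k_{n_k}(t)=D_{n_k}[x^k_{n_k}(t+1)-x^k_{n_k}(t)],\qquad \tilde r^k_{n_k}(t)=g^k_{n_k}(t+1)-g^k_{n_k}(t)-\gamma\tilde v^k_{n_k}(t),$$ abbreviated $\tilde v,\tilde r$, at times $t\in T^k$ with $\tilde v\neq0$ the matrix is updated by $$B^k(t+1)=B^k(t)+\frac{\tilde r\tilde r^T}{\tilde r^T\tilde v}-\frac{B^k(t)\tilde v\tilde v^TB^k(t)}{\tilde v^TB^k(t)\tilde v}+\gamma I,$$ and $B^k(t+1)=B^k(t)$ otherwise. Curvature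 condition: whatever positive stepsizes are used, along the iterates $\tilde v^k_{n_k}(t)^T\tilde r^k_{n_k}(t)>0$ for all $k$ and all $t\in T^k$ at which $\tilde v^k_{n_k}(t)\ne0$. *)

(* Defs.v *)
From HB Require Import structures.
From mathcomp Require Import all_boot all_order all_algebra.
From mathcomp Require Import all_classical all_reals all_analysis.
Set Implicit Arguments.
Unset Strict Implicit.
Unset Printing Implicit Defensive.
Import Order.TTheory GRing.Theory Num.Theory.
Import numFieldNormedType.Exports.
Local Open Scope classical_set_scope.
Local Open Scope ring_scope.

(* R^{np} split into n blocks of size p, in the block-matrix format of matrix.v *)
Notation "''bV[' R ]_ ( n , p )" := 'cV[R]_(\sum_(i < n) p)
  (at level 0, R at level 200, n at level 200, p at level 200) : type_scope.
Notation "''bM[' R ]_ ( n , p )" :=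
  'M[R]_(\sum_(i < n) p, \sum_(i < n) p)
  (at level 0, R at level 200, n at level 200, p at level 200) : type_scope.

Section Blocks.
Context {R : realType} {n p : nat}.

Definition blk (z : 'bV[R]_(n, p)) (i : 'I_n) : 'cV[R]_p :=
  @submxcol R n (fun=> p) 1 z i.

Definition blkmx (A : 'bM[R]_(n, p)) (i j : 'I_n) : 'M[R]_p :=
  @submxblock R n n (fun=> p) (fun=> p) A i j.

End Blocks.

Section Graph.
Context {n : nat} (e : rel 'I_n).

Definition nbh (i : 'I_n) : {set 'I_n} := [set j | (j == i) || e i j].

Definition deg (i : 'I_n) : nat := #|nbh i|.

Context {R : realType} {p : nat}.

(* Coordinates over n_i are numbered by the enumeration [enum_val] of n_i. *)
Definition gather (i : 'I_n) (w : 'I_n -> 'cV[R]_p) : 'bV[R]_(deg i, p) :=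
  \mxcol_(a < deg i) w (@enum_val _ (mem (nbh i)) a).

Definition restr (i : 'I_n) (z : 'bV[R]_(n, p)) : 'bV[R]_(deg i, p) :=
  gather i (blk z).

Definition submx_nbh (i : 'I_n) (A : 'bM[R]_(n, p)) : 'bM[R]_(deg i, p) :=
  \mxblock_(a < deg i, b < deg i)
     blkmx A (@enum_val _ (mem (nbh i)) a) (@enum_val _ (mem (nbh i)) b).

(* Since [enum_val] is injective, the inner sum is the block of u attached to j
   if j is in n_i, and 0 otherwise. *)
Definition pad (i : 'I_n) (u : 'bV[R]_(deg i, p)) : 'bV[R]_(n, p) :=
  \mxcol_(j < n)
     \sum_(a < deg i | @enum_val _ (mem (nbh i)) a == j) blk u a.

Definition Dmx : 'bM[R]_(n, p) :=
  \mxdiag_(i < n) ((deg i)%:R^-1%:M : 'M[R]_p).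

End Graph.

Section Calculus.
Context {R : realType} {N : nat}.

Definition grad (f : 'cV[R]_N -> R) (x : 'cV[R]_N) : 'cV[R]_N :=
  \col_i 'D_(delta_mx i 0) f x.

Definition hess (f : 'cV[R]_N -> R) (x : 'cV[R]_N) : 'M[R]_N :=
  \matrix_(i, j) 'D_(delta_mx j 0) (fun y => grad f y i 0) x.

Definition twice_differentiable (f : 'cV[R]_N -> R) : Prop :=
  (forall x, differentiable f x) /\ (forall x, differentiable (grad f) x).

(* Symmetry is not part of the order: it is automatic for the Hessian of a
   twice (Frechet) differentiable function and is required separately of the
   initial Hessian approximations. *)
Definition loewner_le (A B : 'M[R]_N) : Prop :=
  forall u : 'cV[R]_N, 0 <= (u^T *m (B - A) *m u) 0 0.

End Calculus.

Section Asynchrony.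
Context {n : nat} (T : 'I_n -> set nat).

(* The maximum over the empty set is 0. *)
Definition lastt (i : 'I_n) (t : nat) : nat :=
  \max_(s < t | (s : nat) \in T i) s.

Definition delay (i j : 'I_n) (t : nat) : nat := lastt j (lastt i t).

Definition partially_asynchronous {R : realType} (B : R) : Prop :=
  forall (i j : 'I_n) (t : nat),
    Num.max 0 (t%:R - B + 1) <= (delay i j t)%:R /\ (delay i j t <= t)%N.

End Asynchrony.

Section DBFGS.
Context {R : realType} {n p : nat}.
Variables (e : rel 'I_n) (f : 'bV[R]_(n, p) -> R) (T : 'I_n -> set nat).
Variables (gamma Gamma : R).

Definition xloc (x : nat -> 'bV[R]_(n, p)) (k : 'I_n) (t : nat) :
    'bV[R]_(deg e k, p) :=
  gather e k (fun j => blk (x (delay T k j t)) j).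

Definition gloc (x : nat -> 'bV[R]_(n, p)) (k : 'I_n) (t : nat) :
    'bV[R]_(deg e k, p) :=
  gather e k (fun j => blk (grad f (x (delay T k j t))) j).

Definition vloc (x : nat -> 'bV[R]_(n, p)) (k : 'I_n) (t : nat) :
    'bV[R]_(deg e k, p) :=
  submx_nbh e k (Dmx e) *m (xloc x k t.+1 - xloc x k t).

Definition rloc (x : nat -> 'bV[R]_(n, p)) (k : 'I_n) (t : nat) :
    'bV[R]_(deg e k, p) :=
  gloc x k t.+1 - gloc x k t - gamma *: vloc x k t.

Definition eloc (x : nat -> 'bV[R]_(n, p))
    (Bk : forall k : 'I_n, nat -> 'bM[R]_(deg e k, p)) (k : 'I_n) (t : nat) :
    'bV[R]_(deg e k, p) :=
  - ((invmx (Bk k t) + Gamma *: submx_nbh e k (Dmx e)) *m gloc x k t).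

Definition bfgs_update (m : nat) (B : 'M[R]_m) (v r : 'cV[R]_m) : 'M[R]_m :=
  B + ((r^T *m v) 0 0)^-1 *: (r *m r^T)
    - ((v^T *m B *m v) 0 0)^-1 *: (B *m v *m v^T *m B)
    + gamma%:M.

Definition dbfgs_run (x0 : 'bV[R]_(n, p))
    (B0 : forall k : 'I_n, 'bM[R]_(deg e k, p)) (eps : nat -> R)
    (x : nat -> 'bV[R]_(n, p))
    (Bk : forall k : 'I_n, nat -> 'bM[R]_(deg e k, p)) : Prop :=
  [/\ x 0%N = x0,
      forall t, x t.+1 =
        x t + eps t *: \sum_(k < n | t \in T k) pad (eloc x Bk k t),
      forall k, Bk k 0%N = B0 k
    & forall k t, Bk k t.+1 =
        if (t \in T k) && (vloc x k t != 0)
        then bfgs_update (Bk k t) (vloc x k t) (rloc x k t)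
        else Bk k t].

Definition curvature_condition (x0 : 'bV[R]_(n, p))
    (B0 : forall k : 'I_n, 'bM[R]_(deg e k, p)) : Prop :=
  forall eps x Bk, (forall t, 0 < eps t) -> dbfgs_run x0 B0 eps x Bk ->
  forall k t, t \in T k -> vloc x k t != 0 ->
    0 < ((vloc x k t)^T *m rloc x k t) 0 0.

End DBFGS.

(* Main.v *)
Require Import Defs.
From HB Require Import structures.
From mathcomp Require Import all_boot all_order all_algebra.
From mathcomp Require Import all_classical all_reals all_analysis.
From mathcomp Require Import ring lra.
Set Implicit Arguments.
Unset Strict Implicit.
Unset Printing Implicit Defensive.
Import Order.TTheory GRing.Theory Num.Theory.
Import numFieldNormedType.Exports.
Local Open Scope classical_set_scope.
Local Open Scope ring_scope.

(** The method is a descent method whose gradients are out of date by a bounded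
number of steps, and a small constant stepsize beats any bounded delay.

The curvature condition makes every BFGS update well defined, and the term
[gamma I] added at each update keeps all matrices [B^k(t)] above [gamma I]
([bfgs_update_ge]).  Nothing bounds these matrices from above, so their
inverses may degenerate; the regularization [Gamma D] then still guarantees
descent, while [gamma^-1] bounds the inverses.  Hence, with [ghat] the delayed
local gradient seen by node [k], the local direction [e^k] satisfies
[|e^k|^2 <= C |ghat|^2] and [ghat . e^k <= - a |ghat|^2] for constants
[a, C > 0] ([sq_eloc_le], [dot_eloc_le]).

The Hessian bounds make the gradient Lipschitz ([grad_lipschitz]).  They bound
a quadratic form rather than an operator norm, so they are used along lines:
integrating them twice gives convexity and the quadratic upper model
([first_order_bounds]), whence cocoercivity of the gradient ([cocoercive]) by
the argument of Baillon and Haddad.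

Let [G(t)] be the sum of [|ghat^k(t)|^2] over the nodes active at time [t].
One step moves [x] by at most [eps] times a multiple of [sqrt G(t)], so a
gradient delayed by at most [M] steps differs from the current one, in squared
norm, by at most [eps^2] times a multiple of [G(t-M) + ... + G(t-1)].  The
quadratic model then gives ([one_step_descent])
[f(x(t+1)) <= f(x(t)) - eps a G(t) + eps^2 K (G(t-M) + ... + G(t))].
Each [G(s)] occurs in at most [M+1] of these inequalities, so after summation
the quadratic error is absorbed by the linear decrease once [eps] is small, and
[sum_t G(t)] is finite because [f] is bounded below
([psum_activity_bounded]).  Finally every node is active at least once in each
window of bounded length, so [|g(t)|^2] is bounded by a multiple of a window sum
of [G], which tends to 0 ([sq_grad_le], [async_grad_cvg0]). *)

(** * Euclidean inner product *)

Definition dot {R : realType} {N : nat} (u v : 'cV[R]_N) : R := (u^T *m v) 0 0.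

Notation sq u := (dot u u).

Section Dot.
Context {R : realType} {N : nat}.
Implicit Types u v w : 'cV[R]_N.

Lemma dotE u v : dot u v = \sum_i u i 0 * v i 0.
Proof. by rewrite /dot mxE; apply: eq_bigr => i _; rewrite mxE. Qed.

Lemma dotC u v : dot u v = dot v u.
Proof. by rewrite !dotE; apply: eq_bigr => i _; rewrite mulrC. Qed.

Lemma dotDr u v w : dot u (v + w) = dot u v + dot u w.
Proof. by rewrite /dot mulmxDr mxE. Qed.

Lemma dotDl u v w : dot (v + w) u = dot v u + dot w u.
Proof. by rewrite dotC dotDr !(dotC u). Qed.

Lemma dotNr u v : dot u (- v) = - dot u v.
Proof. by rewrite /dot mulmxN mxE. Qed.

Lemma dotNl u v : dot (- u) v = - dot u v.
Proof. by rewrite dotC dotNr dotC. Qed.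

Lemma dotZr a u v : dot u (a *: v) = a * dot u v.
Proof. by rewrite /dot -scalemxAr mxE. Qed.

Lemma dotZl a u v : dot (a *: u) v = a * dot u v.
Proof. by rewrite dotC dotZr dotC. Qed.

Lemma dot0r u : dot u 0 = 0.
Proof. by rewrite /dot mulmx0 mxE. Qed.

Lemma dot0l u : dot 0 u = 0.
Proof. by rewrite dotC dot0r. Qed.

Lemma dot_sumr (I : Type) (r : seq I) (P : pred I) (F : I -> 'cV[R]_N) u :
  dot u (\sum_(i <- r | P i) F i) = \sum_(i <- r | P i) dot u (F i).
Proof. exact: (big_morph (dot u) (dotDr u) (dot0r u)). Qed.

Definition dotE_lin := (dotDr, dotDl, dotNr, dotNl, dotZr, dotZl).

Lemma sqN u : sq (- u) = sq u.
Proof. by rewrite dotNl dotNr opprK. Qed.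

Lemma sq_ge0 u : 0 <= sq u.
Proof. by rewrite dotE; apply: sumr_ge0 => i _; rewrite -expr2 sqr_ge0. Qed.

Lemma sq_eq0 u : sq u = 0 -> u = 0.
Proof.
rewrite dotE => /psumr_eq0P u0; apply/colP => i; rewrite mxE.
have /eqP := u0 (fun i _ => sqr_ge0 (u i 0)) i isT.
by rewrite mulf_eq0 orbb => /eqP.
Qed.

Lemma sqr_coord_le u i : u i 0 ^+ 2 <= sq u.
Proof.
rewrite dotE (bigD1 i) //= -expr2 lerDl; apply: sumr_ge0 => j _.
by rewrite -expr2 sqr_ge0.
Qed.

Lemma young c u v : 0 < c -> dot u v *+ 2 <= c * sq u + c^-1 * sq v.
Proof.
move=> c_gt0; have c_neq0 : c != 0 by rewrite gt_eqF.
rewrite -subr_ge0 -(pmulr_rge0 _ c_gt0).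
have := sq_ge0 (c *: u - v); rewrite !dotE_lin (dotC v u).
by congr (0 <= _); field.
Qed.

Lemma young1 u v : dot u v *+ 2 <= sq u + sq v.
Proof. by have := young u v (ltr01 : 0 < 1 :> R); rewrite invr1 !mul1r. Qed.

Lemma sqD_le u v : sq (u + v) <= 2 * sq u + 2 * sq v.
Proof. have := sq_ge0 (u - v); rewrite !dotE_lin (dotC v u) => ?; lra. Qed.

(** Jensen's inequality, by induction: the cross terms are split with [young1]. *)
Lemma sq_sum_le (I : eqType) (r : seq I) (P : pred I) (F : I -> 'cV[R]_N) :
  sq (\sum_(i <- r | P i) F i) <= (size r)%:R * \sum_(i <- r | P i) sq (F i).
Proof.
rewrite -2!(big_filter r P); set s := [seq i <- r | P i].
apply: (@le_trans _ _ ((size s)%:R * \sum_(i <- s) sq (F i))); last first.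
  apply: ler_wpM2r; last by rewrite ler_nat size_filter count_size.
  by apply: sumr_ge0 => i _; exact: sq_ge0.
elim: s => [|i s IHs]; first by rewrite !big_nil dot0r mul0r.
rewrite !big_cons /=; set U := \sum_(j <- s) F j in IHs *.
have cross : dot (F i) U *+ 2 <= (size s)%:R * sq (F i) + \sum_(j <- s) sq (F j).
  rewrite /U dot_sumr -sumrMnl -[size s in leRHS]sum1_size natr_sum mulr_suml.
  by rewrite -big_split /=; apply: ler_sum => j _; rewrite mul1r young1.
rewrite !dotE_lin (dotC U) -natr1.
have -> : sq (F i) + dot (F i) U + (dot (F i) U + sq U)
  = sq (F i) + dot (F i) U *+ 2 + sq U by ring.
apply: (le_trans (lerD (lerD (lexx _) cross) IHs)).
by rewrite le_eqVlt; apply/orP; left; apply/eqP; ring.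
Qed.

End Dot.

Lemma dot_mulmx {R : realType} {N M : nat} (A : 'M[R]_(N, M)) u v :
  dot u (A *m v) = dot (A^T *m u) v.
Proof. by rewrite /dot trmx_mul trmxK mulmxA. Qed.

(** * Blocks and neighbourhoods *)

Section Blocks.
Context {R : realType} {n p : nat}.
Implicit Types u v : 'bV[R]_(n, p).

Lemma dot_blk u v : dot u v = \sum_i dot (blk u i) (blk v i).
Proof.
rewrite /dot -[in LHS](submxcolK u) -[in LHS](submxcolK v) tr_mxcol.
by rewrite mul_mxrow_mxcol summxE.
Qed.

Lemma blkB u v i : blk (u - v) i = blk u i - blk v i.
Proof. exact: submxcolB. Qed.

Lemma sq_blk_le u i : sq (blk u i) <= sq u.
Proof.
rewrite (dot_blk u) (bigD1 i) //= lerDl.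
by apply: sumr_ge0 => j _; exact: sq_ge0.
Qed.

Lemma blkP u v : (forall i, blk u i = blk v i) -> u = v.
Proof.
move=> uv; rewrite -(submxcolK u) -(submxcolK v); apply/eq_mxcol => i.
exact: uv.
Qed.

End Blocks.

Section Neighbourhoods.
Context {R : realType} {n p : nat} (e : rel 'I_n).
Implicit Types (k i j : 'I_n) (z : 'bV[R]_(n, p)).

Local Notation nbr k := (@enum_val _ (mem (nbh e k))).

Lemma deg_gt0 k : (0 < deg e k)%N.
Proof. by apply/card_gt0P; exists k; rewrite inE eqxx. Qed.

Lemma deg_le k : (deg e k <= n)%N.
Proof. by rewrite -[leqRHS]card_ord max_card. Qed.

Lemma blk_gather k (w : 'I_n -> 'cV[R]_p) a : blk (gather e k w) a = w (nbr k a).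
Proof. exact: mxcolK. Qed.

Lemma gatherB k (w w' : 'I_n -> 'cV[R]_p) :
  gather e k w - gather e k w' = gather e k (fun j => w j - w' j).
Proof. by apply: blkP => a; rewrite blkB !blk_gather. Qed.

Lemma sq_gather k (w : 'I_n -> 'cV[R]_p) :
  sq (gather e k w) = \sum_(j in nbh e k) sq (w j).
Proof.
rewrite dot_blk [RHS]big_enum_val; by apply: eq_bigr => a _; rewrite blk_gather.
Qed.

Lemma sq_gather_le k (w : 'I_n -> 'cV[R]_p) : sq (gather e k w) <= \sum_j sq (w j).
Proof.
rewrite sq_gather [leRHS](bigID (mem (nbh e k))) /= lerDl.
by apply: sumr_ge0 => j _; exact: sq_ge0.
Qed.

Lemma sq_gather_self k (w : 'I_n -> 'cV[R]_p) : sq (w k) <= sq (gather e k w).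
Proof.
rewrite sq_gather (bigD1 k) /=; last by rewrite inE eqxx.
by rewrite lerDl; apply: sumr_ge0 => j _; exact: sq_ge0.
Qed.

Lemma blk_pad k (u : 'bV[R]_(deg e k, p)) j :
  blk (pad u) j = \sum_(a < deg e k | nbr k a == j) blk u a.
Proof. exact: mxcolK. Qed.

(** Padding and restriction are adjoint: this turns the inner product of the
global gradient with a sum of padded directions into a sum of local ones. *)
Lemma dot_pad k z (u : 'bV[R]_(deg e k, p)) : dot z (pad u) = dot (restr e k z) u.
Proof.
rewrite !dot_blk.
transitivity (\sum_j \sum_(a < deg e k | nbr k a == j)
    dot (blk z (nbr k a)) (blk u a)).
  apply: eq_bigr => j _; rewrite blk_pad dot_sumr.
  by apply: eq_bigr => a /eqP ->.
rewrite (exchange_big_dep xpredT) //=; apply: eq_bigr => a _.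
by rewrite (big_pred1 (nbr k a)) ?blk_gather // => j; rewrite eq_sym.
Qed.

Lemma restr_pad k (u : 'bV[R]_(deg e k, p)) : restr e k (pad u) = u.
Proof.
apply: blkP => a; rewrite blk_gather blk_pad (big_pred1 a) // => b.
by rewrite /= (inj_eq enum_val_inj).
Qed.

Lemma sq_pad k (u : 'bV[R]_(deg e k, p)) : sq (pad u) = sq u.
Proof. by rewrite dot_pad restr_pad. Qed.

Lemma blkmx_Dmx i j :
  blkmx (Dmx e : 'bM[R]_(n, p)) i j = ((deg e i)%:R^-1 *+ (i == j))%:M.
Proof.
rewrite /blkmx mxblockK; case: eqP => _; last by rewrite mulr0n -scalemx1 scale0r.
by rewrite conform_mx_id mulr1n.
Qed.

(** The enumeration of a neighbourhood is injective, so no diagonal block of D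
lands off the diagonal. *)
Lemma submx_nbh_Dmx k : submx_nbh e k (Dmx e) =
  \mxdiag_(a < deg e k) ((deg e (nbr k a))%:R^-1%:M : 'M[R]_p).
Proof.
rewrite /mxdiag /submx_nbh; apply: eq_mxblock => a b.
rewrite blkmx_Dmx (inj_eq enum_val_inj); case: eqP => [->|_].
  by rewrite conform_mx_id mulr1n.
by rewrite mulr0n -scalemx1 scale0r.
Qed.

Lemma blk_Dloc k (u : 'bV[R]_(deg e k, p)) a :
  blk (submx_nbh e k (Dmx e) *m u) a = (deg e (nbr k a))%:R^-1 *: blk u a.
Proof.
rewrite submx_nbh_Dmx -[u in LHS]submxcolK mul_mxdiag_mxcol /blk mxcolK.
by rewrite mul_scalar_mx.
Qed.

(** Neighbourhoods have at most n nodes; [n.+1] rather than [n] makes the constant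
positive for the empty network too, which then needs no separate treatment. *)
Lemma Dloc_lower k (u : 'bV[R]_(deg e k, p)) :
  n.+1%:R^-1 * sq u <= dot u (submx_nbh e k (Dmx e) *m u).
Proof.
rewrite !dot_blk mulr_sumr; apply: ler_sum => a _.
rewrite blk_Dloc dotZr ler_wpM2r ?sq_ge0 //.
by rewrite lef_pV2 ?posrE ?ltr0n ?deg_gt0 // ler_nat leqW // deg_le.
Qed.

Lemma Dloc_upper k (u : 'bV[R]_(deg e k, p)) :
  sq (submx_nbh e k (Dmx e) *m u) <= sq u.
Proof.
rewrite !dot_blk; apply: ler_sum => a _.
rewrite blk_Dloc dotZr dotZl mulrA ler_piMl ?sq_ge0 //.
rewrite mulr_ile1 ?invr_ge0 ?ler0n ?invf_le1 ?ltr0n ?ler1n ?deg_gt0 //.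
Qed.

End Neighbourhoods.

(** * Matrices bounded below and the BFGS update *)

Section PositiveMatrices.
Context {R : realType} {N : nat}.
Implicit Types (c : R) (A : 'M[R]_N) (u v w g r : 'cV[R]_N).

Lemma loewner_geP c A :
  loewner_le c%:M A <-> forall u, c * sq u <= dot u (A *m u).
Proof.
suff quadE u : (u^T *m (A - c%:M) *m u) 0 0 = dot u (A *m u) - c * sq u.
  by split=> cA u; have := cA u; rewrite quadE subr_ge0.
by rewrite -mulmxA -/(dot u _) mulmxBl mul_scalar_mx dotDr dotNr dotZr.
Qed.

Lemma loewner_leP c A :
  loewner_le A c%:M <-> forall u, dot u (A *m u) <= c * sq u.
Proof.
suff quadE u : (u^T *m (c%:M - A) *m u) 0 0 = c * sq u - dot u (A *m u).
  by split=> cA u; have := cA u; rewrite quadE subr_ge0.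
by rewrite -mulmxA -/(dot u _) mulmxBl mul_scalar_mx dotDr dotNr dotZr.
Qed.

Lemma loewner_unitmx c A : 0 < c -> loewner_le c%:M A -> A \in unitmx.
Proof.
move=> c_gt0 /loewner_geP cA; rewrite -row_free_unit; apply: inj_row_free => v vA.
apply: trmx_inj; rewrite trmx0; apply: sq_eq0.
have := cA v^T; rewrite dot_mulmx.
have -> : A^T *m v^T = 0 by rewrite -trmx_mul vA trmx0.
rewrite dot0l => cv; apply/eqP; rewrite eq_le sq_ge0 andbT.
by rewrite -(ler_pM2l c_gt0) mulr0.
Qed.

Section Inverse.
Variables (c : R) (A : 'M[R]_N).
Hypotheses (c_gt0 : 0 < c) (cA : loewner_le c%:M A).

(* The lower bound on A, applied to the solution of A y = g. *)
Let coercive g : c * sq (invmx A *m g) <= dot g (invmx A *m g).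
Proof.
have /loewner_geP/(_ (invmx A *m g)) := cA.
by rewrite mulmxA mulmxV ?mul1mx ?(loewner_unitmx c_gt0 cA) // (dotC _ g).
Qed.

Lemma invmx_dot_ge0 g : 0 <= dot g (invmx A *m g).
Proof. by apply: le_trans (coercive g); rewrite mulr_ge0 ?sq_ge0 ?ltW. Qed.

Lemma invmx_sq_le g : sq (invmx A *m g) <= c^-1 ^+ 2 * sq g.
Proof.
have c'_gt0 : 0 < c^-1 by rewrite invr_gt0.
have := coercive g; have := young g (invmx A *m g) c'_gt0; rewrite invrK => yg cg.
have : c * sq (invmx A *m g) <= c^-1 * sq g by lra.
by rewrite expr2 -mulrA -ler_pdivlMl // invrK.
Qed.

End Inverse.

Lemma outer_mulmx u v w : u *m v^T *m w = dot v w *: u.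
Proof. by rewrite -mulmxA [v^T *m w]mx11_scalar mul_mx_scalar. Qed.

Lemma bfgs_update_sym c A v r :
  A^T = A -> (bfgs_update c A v r)^T = bfgs_update c A v r.
Proof.
move=> A_sym; have trD (X Y : 'M[R]_N) : (X + Y)^T = X^T + Y^T by exact: linearD.
have trZ b (X : 'M[R]_N) : (b *: X)^T = b *: X^T by exact: linearZ.
have trN (X : 'M[R]_N) : (- X)^T = - X^T by exact: linearN.
rewrite /bfgs_update !trD trN !trZ tr_scalar_mx.
by rewrite !trmx_mul !trmxK A_sym !mulmxA.
Qed.

(** The rank-two correction keeps the matrix positive semidefinite (this is
Cauchy-Schwarz for the inner product defined by A), so the term [c I] added at
the end restores the lower bound c, however small the corrected matrix is. *)
Lemma bfgs_update_ge c A v r : 0 < c -> A^T = A -> loewner_le c%:M A ->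
  v != 0 -> 0 < dot v r -> loewner_le c%:M (bfgs_update c A v r).
Proof.
move=> c_gt0 A_sym cA v_neq0 vr_gt0; apply/loewner_geP => u.
have /loewner_geP Ac := cA.
have sA x y : dot x (A *m y) = dot y (A *m x) by rewrite dot_mulmx A_sym dotC.
have vAv_gt0 : 0 < dot v (A *m v).
  apply: lt_le_trans (Ac v); rewrite mulr_gt0 // lt_def sq_ge0 andbT.
  by apply: contra v_neq0 => /eqP/sq_eq0 ->.
have A_ge0 x : 0 <= dot x (A *m x).
  by apply: le_trans (Ac x); rewrite mulr_ge0 ?sq_ge0 ?ltW.
(* Cauchy-Schwarz: A is nonnegative at the component of u that is A-orthogonal
   to v. *)
have := A_ge0 (u - ((dot v (A *m v))^-1 * dot v (A *m u)) *: v).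
rewrite mulmxBr -scalemxAr !dotE_lin (sA u v) => proj_ge0.
rewrite /bfgs_update -!/(dot _ _) -(mulmxA v^T) -/(dot v _) (dotC r v).
rewrite !mulmxDl mulNmx -!scalemxAl outer_mulmx -(mulmxA _ A u) outer_mulmx.
rewrite mul_scalar_mx.
set w := A *m v in proj_ge0 vAv_gt0 *; set z := A *m u in proj_ge0 *.
rewrite !dotE_lin (sA u v) -/z lerDr (dotC u r).
rewrite addrAC; apply: addr_ge0; last first.
  by apply: mulr_ge0; rewrite ?invr_ge0 ?(ltW vr_gt0) // -expr2 sqr_ge0.
apply: (le_trans proj_ge0); rewrite le_eqVlt; apply/orP; left; apply/eqP.
by field; rewrite gt_eqF.
Qed.

End PositiveMatrices.

(** * Convexity and Lipschitz gradient from Hessian bounds *)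

Section Calculus.
Context {R : realType} {N : nat}.
Implicit Types (f : 'cV[R]_N -> R) (x y u : 'cV[R]_N).

Lemma derive_dot_grad f x u : differentiable f x -> 'D_u f x = dot (grad f x) u.
Proof.
move=> df; rewrite deriveE // {1}(matrix_sum_delta u) dotE linear_sum.
apply: eq_bigr => i _; rewrite big_ord1 linearZ /= mxE deriveE //.
by rewrite mulrC.
Qed.

Lemma is_derive_line f x u (s : R) : differentiable f (x + s *: u) ->
  is_derive s 1 (fun s => f (x + s *: u)) (dot (grad f (x + s *: u)) u).
Proof.
move=> df; rewrite -derive_dot_grad //; have fu := @diff_derivable _ _ _ f _ u df.
(* Both derivatives are limits of the same difference quotient. *)
have quotE : (fun h : R => h^-1 *: (((fun s => f (x + s *: u)) \o shift s) (h *: 1)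
    - f (x + s *: u))) =
  (fun h : R => h^-1 *: ((f \o shift (x + s *: u)) (h *: u) - f (x + s *: u))).
  apply: funext => h /=; congr (_ *: (f _ - _)).
  by rewrite scalerDl addrCA [h *: 1]mulr1.
by apply: DeriveDef; rewrite /derivable /derive quotE.
Qed.

Lemma is_derive_quadratic (a b c s : R) :
  is_derive s 1 (fun s => a + b * s + c * s ^+ 2) (b + c * (2 * s)).
Proof.
have Did := is_derive_id s (1 : R).
have D := is_deriveD (is_deriveD (is_derive_cst a s (1 : R)) (is_deriveZ b Did))
  (is_deriveZ c (is_deriveX 2 Did)).
have eqD : 0 + b *: 1 + c *: ((2%:R * id s ^+ 2.-1) *: 1) = b + c * (2 * s).
  by rewrite add0r [b *: 1]mulr1 expr1 [_ *: 1]mulr1.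
exact: (is_derive_eq D eqD).
Qed.

Lemma le_of_deriv_le (phi psi dphi dpsi : R -> R) :
  (forall s : R, is_derive s 1 phi (dphi s)) ->
  (forall s : R, is_derive s 1 psi (dpsi s)) ->
  (forall s : R, 0 <= s -> dphi s <= dpsi s) -> phi 0 <= psi 0 ->
  forall s : R, 0 <= s -> phi s <= psi s.
Proof.
move=> Dphi Dpsi le_d le0 s s_ge0.
have D (t : R) : is_derive t 1 (psi - phi) (dpsi t - dphi t) by exact: is_deriveB.
have cont : {within `[0, s], continuous (psi - phi)}.
  by apply: derivable_within_continuous => t _; exact: ex_derive.
have [c /itvP c_in] := MVT_segment s_ge0 (fun t _ => D t) cont.
rewrite /= subr0 => eq_diff; rewrite -subr_ge0.
have : 0 <= (dpsi c - dphi c) * s by rewrite mulr_ge0 // subr_ge0 le_d // c_in.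
by rewrite -eq_diff !fctE; lra.
Qed.

End Calculus.

Section SmoothConvex.
Context {R : realType} {N : nat}.
Variables (f : 'cV[R]_N -> R) (L : R).
Hypothesis f_diff2 : twice_differentiable f.
Hypothesis f_hess : forall x, loewner_le 0 (hess f x) /\ loewner_le (hess f x) L%:M.
Hypothesis L_gt0 : 0 < L.
Implicit Types x y u : 'cV[R]_N.

Let slope x u (s : R) : R := dot (grad f (x + s *: u)) u.

Let is_derive_slope x u (s : R) :
  is_derive s 1 (slope x u) (dot u (hess f (x + s *: u) *m u)).
Proof.
have [_ dg] := f_diff2.
have dgi i y : differentiable (fun y => grad f y i 0) y.
  apply: (@differentiable_comp _ _ _ _ (grad f) (fun M : 'cV[R]_N => M i 0)) => //.
  exact: differentiable_coord.
have -> : slope x u = \sum_i (fun s : R => grad f (x + s *: u) i 0 * u i 0).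
  by apply: funext => t; rewrite /slope dotE fct_sumE.
have -> : dot u (hess f (x + s *: u) *m u) =
    \sum_i dot (grad (fun y => grad f y i 0) (x + s *: u)) u * u i 0.
  rewrite dotE; apply: eq_bigr => i _; rewrite mulrC; congr (_ * _).
  by rewrite mxE dotE; apply: eq_bigr => j _; rewrite !mxE.
apply: is_derive_sum => i.
have -> : (fun s : R => grad f (x + s *: u) i 0 * u i 0) =
    u i 0 *: (fun s : R => grad f (x + s *: u) i 0).
  by apply: funext => t; rewrite fctE /= mulrC.
rewrite mulrC; apply: is_deriveZ; exact: (is_derive_line (dgi i _)).
Qed.

Let slope_bounds x u (s : R) : 0 <= s ->
  slope x u 0 <= slope x u s /\ slope x u s <= slope x u 0 + L * sq u * s.
Proof.
move=> s_ge0; split.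
- have Dcst t := is_derive_quadratic (slope x u 0) 0 0 t.
  have le_d (t : R) : 0 <= t ->
      0 + 0 * (2 * t) <= dot u (hess f (x + t *: u) *m u).
    by have [/(_ u)] := f_hess (x + t *: u); rewrite subr0 -mulmxA mul0r addr0.
  have le0 : slope x u 0 + 0 * 0 + 0 * 0 ^+ 2 <= slope x u 0.
    by rewrite !mul0r !addr0.
  have := le_of_deriv_le Dcst (is_derive_slope x u) le_d le0 s_ge0.
  by rewrite !mul0r !addr0.
- have Dlin t := is_derive_quadratic (slope x u 0) (L * sq u) 0 t.
  have le_d (t : R) : 0 <= t ->
      dot u (hess f (x + t *: u) *m u) <= L * sq u + 0 * (2 * t).
    by have [_ /loewner_leP] := f_hess (x + t *: u); rewrite mul0r addr0.
  have le0 : slope x u 0 <= slope x u 0 + L * sq u * 0 + 0 * 0 ^+ 2.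
    by rewrite mulr0 mul0r !addr0.
  have := le_of_deriv_le (is_derive_slope x u) Dlin le_d le0 s_ge0.
  by rewrite mul0r addr0.
Qed.

(** Along the segment from x to y the slope of f grows at a rate between 0 and
[L |y - x|^2]; comparing f with a line and a parabola gives convexity and the
quadratic upper model. *)
Lemma first_order_bounds x y :
  f x + dot (grad f x) (y - x) <= f y /\
  f y <= f x + dot (grad f x) (y - x) + L / 2 * sq (y - x).
Proof.
set u := y - x; have [df _] := f_diff2.
have Df t := is_derive_line (df (x + t *: u)).
have slope0 : slope x u 0 = dot (grad f x) u by rewrite /slope scale0r addr0.
have f0 : f (x + 0 *: u) = f x by rewrite scale0r addr0.
have f1 : f (x + 1 *: u) = f y by rewrite scale1r addrC subrK.
split.
- have Dlin t := is_derive_quadratic (f x) (slope x u 0) 0 t.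
  have le_d (t : R) : 0 <= t -> slope x u 0 + 0 * (2 * t) <= slope x u t.
    by move=> t_ge0; rewrite mul0r addr0; have [] := slope_bounds x u t_ge0.
  have le0 : f x + slope x u 0 * 0 + 0 * 0 ^+ 2 <= f (x + 0 *: u).
    by rewrite f0 mulr0 mul0r !addr0.
  have := le_of_deriv_le Dlin Df le_d le0 ler01.
  by rewrite f1 slope0 mulr1 mul0r addr0.
- have Dquad t := is_derive_quadratic (f x) (slope x u 0) (L / 2 * sq u) t.
  have le_d (t : R) : 0 <= t ->
      slope x u t <= slope x u 0 + L / 2 * sq u * (2 * t).
    move=> t_ge0; have [_] := slope_bounds x u t_ge0.
    by congr (_ <= _ + _); field.
  have le0 : f (x + 0 *: u) <= f x + slope x u 0 * 0 + L / 2 * sq u * 0 ^+ 2.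
    by rewrite f0 expr0n !mulr0 !addr0.
  have := le_of_deriv_le Df Dquad le_d le0 ler01.
  by rewrite f1 slope0 expr1n !mulr1.
Qed.

(** The function [f - grad f x . _] is convex and minimal at x; a gradient step
of length [1/L] from y lowers it by the announced amount, yet not below its
minimum. *)
Lemma cocoercive x y :
  f x + dot (grad f x) (y - x) + (2 * L)^-1 * sq (grad f y - grad f x) <= f y.
Proof.
set h := grad f y - grad f x.
have [lo _] := first_order_bounds x (y - L^-1 *: h).
have [_ up] := first_order_bounds y (y - L^-1 *: h).
have L_neq0 : L != 0 by rewrite gt_eqF.
have stepE : y - L^-1 *: h - y = - (L^-1 *: h) by rewrite addrAC subrr add0r.
have sqh : sq h = dot (grad f y) h - dot (grad f x) h by rewrite {1}/h dotDl dotNl.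
have yxE : y - L^-1 *: h - x = y - x - L^-1 *: h by rewrite addrAC.
move: lo up; rewrite stepE yxE dotDr !dotNr !dotNl !dotZr !dotZl.
have -> : (2 * L)^-1 * sq h =
    L^-1 * (dot (grad f y) h - dot (grad f x) h) - L / 2 * (L^-1 * (L^-1 * sq h)).
  by rewrite -sqh; field.
lra.
Qed.

(** Adding the cocoercivity inequalities at (x, y) and (y, x) bounds
[|grad f y - grad f x|^2] by L times an inner product with [y - x]. *)
Lemma grad_lipschitz x y : sq (grad f y - grad f x) <= L ^+ 2 * sq (y - x).
Proof.
have := cocoercive x y; have := cocoercive y x.
have -> : grad f x - grad f y = - (grad f y - grad f x) by rewrite opprB.
have -> : x - y = - (y - x) by rewrite opprB.
rewrite sqN dotNr; set h := grad f y - grad f x; set d := y - x.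
have -> : (2 * L)^-1 = L^-1 / 2 by rewrite invfM mulrC.
move=> lo1 lo2.
have : L^-1 * sq h <= dot (grad f y) d - dot (grad f x) d by lra.
rewrite -dotNl -dotDl -/h.
have := @young _ _ L d h L_gt0; rewrite (dotC d) => yg hd.
have : L^-1 * sq h <= L * sq d by lra.
by rewrite ler_pdivrMl // expr2 mulrA.
Qed.

End SmoothConvex.

(** * Bounded delays *)

Section Delays.
Context {n : nat} (T : 'I_n -> set nat).

Lemma lastt_le i t : (lastt T i t <= t.-1)%N.
Proof.
by apply/bigmax_leqP => -[s /= lt_st] _; case: t lt_st => // t; rewrite ltnS.
Qed.

Lemma lastt_in i t : (0 < lastt T i t)%N -> lastt T i t \in T i.
Proof.
suff: lastt T i t = 0%N \/ lastt T i t \in T i by case=> [->|].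
rewrite /lastt; elim/big_ind: _ => [|a b|s]; [by left| |by right].
by case: leqP.
Qed.

Lemma delay_le i j t : (delay T i j t <= t.-1)%N.
Proof.
apply: (leq_trans (lastt_le _ _)); apply: (leq_trans (leq_pred _)).
exact: lastt_le.
Qed.

Lemma delay_bounded (R : realType) (B : R) : partially_asynchronous T B ->
  exists M, forall i j t, (t <= delay T i j t + M)%N.
Proof.
move=> async; exists (Num.bound `|B|) => i j t.
have [] := async i j t; rewrite ge_max => /andP[_ lb] _.
rewrite -(ler_nat R) natrD.
have := le_trans (ler_norm B) (ltW (archi_boundP (normr_ge0 B))).
lra.
Qed.

End Delays.

(** * Recursion on the whole past *)

(** Delayed iterations depend on all previous states, not on the last one only.
The auxiliary function [H t] is a history that is correct up to time t. *)
Lemma history_recursion (A : Type) (a0 : A) (F : nat -> (nat -> A) -> A) :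
  (forall t h h', (forall s, (s <= t)%N -> h s = h' s) -> F t h = F t h') ->
  exists h, h 0%N = a0 /\ forall t, h t.+1 = F t h.
Proof.
move=> F_ext.
pose H := fix H t := if t is t'.+1
  then fun s => if (s <= t')%N then H t' s else F t' (H t') else fun=> a0.
have HS t s : (s <= t)%N -> H t s = H s s.
  elim: t => [|t IHt]; first by rewrite leqn0 => /eqP ->.
  rewrite leq_eqVlt ltnS => /orP[/eqP -> //|st] /=.
  by rewrite st IHt.
exists (fun t => H t t); split=> // t /=; rewrite ltnn.
by apply: F_ext => s st; rewrite HS.
Qed.

(** * Window sums of nonnegative series *)

Section PartialSums.
Context {R : realType} (a : nat -> R).
Hypothesis a_ge0 : forall t, 0 <= a t.

Definition psum (t : nat) : R := \sum_(0 <= r < t) a r.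

Lemma psumS t : psum t.+1 = psum t + a t.
Proof. by rewrite /psum big_nat_recr. Qed.

Lemma psum0 : psum 0 = 0.
Proof. by rewrite /psum big_geq. Qed.

Lemma psum_homo s t : (s <= t)%N -> psum s <= psum t.
Proof.
move=> /subnK <-; elim: (t - s)%N => [//|d IHd].
by rewrite addSn psumS (le_trans IHd) // lerDl.
Qed.

Lemma psum_ge0 t : 0 <= psum t.
Proof. by apply: sumr_ge0. Qed.

Lemma psumB s t : (s <= t)%N -> \sum_(s <= r < t) a r = psum t - psum s.
Proof.
by move=> st; apply/eqP; rewrite eq_sym subr_eq addrC -big_cat_nat.
Qed.

(** Every term belongs to at most m windows of length m. *)
Lemma sum_window_le m N :
  \sum_(0 <= t < N) (psum t - psum (t - m)) <= m%:R * psum N.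
Proof.
elim: m => [|m IHm]; first by rewrite mul0r big1 // => t _; rewrite subn0 subrr.
have -> : \sum_(0 <= t < N) (psum t - psum (t - m.+1)) =
  \sum_(0 <= t < N) (psum t - psum (t - m)) +
  \sum_(0 <= t < N) (psum (t.+1 - m.+1) - psum (t - m.+1)).
  by rewrite -big_split; apply: eq_bigr => t _; rewrite subSS /= addrA subrK.
(* The terms gained by lengthening the windows telescope, since
   t - m = t.+1 - m.+1 also for truncated subtraction. *)
rewrite (telescope_sumr (fun t => psum (t - m.+1))) // sub0n psum0.
rewrite subr0 -natr1 mulrDl mul1r lerD ?psum_homo ?leq_subr //.
Qed.

Lemma window_cvg0 m C : (forall N, psum N <= C) ->
  psum t - psum (t - m) @[t --> \oo] --> (0 : R).
Proof.
move=> le_C.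
have cvg_psum : cvgn psum.
  apply: nondecreasing_is_cvgn; first by move=> s t; exact: psum_homo.
  by exists C => _ [N _ <-].
rewrite -(subrr (limn psum)); apply: cvgB => //.
exact: (cvg_comp _ _ (cvg_subnr m) cvg_psum).
Qed.

End PartialSums.

(** * Runs of the method and their directions *)

Section Runs.
Context {R : realType} {n p : nat}.
Variables (e : rel 'I_n) (f : 'bV[R]_(n, p) -> R) (T : 'I_n -> set nat).
Variables (gamma Gamma : R).

Lemma xloc_ext (x x' : nat -> 'bV[R]_(n, p)) k t :
  (forall s, (s <= t.-1)%N -> x s = x' s) -> xloc e T x k t = xloc e T x' k t.
Proof.
by move=> xx'; congr gather; apply: funext => j; rewrite xx' // delay_le.
Qed.

Lemma gloc_ext (x x' : nat -> 'bV[R]_(n, p)) k t :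
  (forall s, (s <= t.-1)%N -> x s = x' s) -> gloc e f T x k t = gloc e f T x' k t.
Proof.
by move=> xx'; congr gather; apply: funext => j; rewrite xx' // delay_le.
Qed.

(** The update of a matrix at time t mentions the data of time [t.+1], but these
are delayed by at least one step and hence known at time t. *)
Lemma dbfgs_run_exists x0 (B0 : forall k : 'I_n, 'bM[R]_(deg e k, p)) eps :
  exists x Bk, dbfgs_run f T gamma Gamma x0 B0 eps x Bk.
Proof.
pose state : Type := 'bV[R]_(n, p) * (forall k : 'I_n, 'bM[R]_(deg e k, p)).
pose xs (h : nat -> state) s := (h s).1.
pose Bs (h : nat -> state) k s := (h s).2 k.
pose F t (h : nat -> state) : state :=
  (xs h t + eps t *: \sum_(k < n | t \in T k) pad (eloc f T Gamma (xs h) (Bs h) k t),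
   fun k => if (t \in T k) && (vloc e T (xs h) k t != 0)
     then bfgs_update gamma (Bs h k t) (vloc e T (xs h) k t)
                      (rloc e f T gamma (xs h) k t)
     else Bs h k t).
have F_ext t h h' : (forall s, (s <= t)%N -> h s = h' s) -> F t h = F t h'.
  move=> hh'.
  have xx' s : (s <= t)%N -> xs h s = xs h' s by move=> st; rewrite /xs hh'.
  have xx'1 s : (s <= t.-1)%N -> xs h s = xs h' s.
    by move=> st; rewrite xx' // (leq_trans st) ?leq_pred.
  have BB' k : Bs h k t = Bs h' k t by rewrite /Bs hh'.
  have gg' k := gloc_ext k xx'1.
  have vv' k : vloc e T (xs h) k t = vloc e T (xs h') k t.
    by rewrite /vloc (xloc_ext k xx'1) (@xloc_ext (xs h) (xs h') k t.+1).
  have rr' k : rloc e f T gamma (xs h) k t = rloc e f T gamma (xs h') k t.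
    by rewrite /rloc vv' gg' (@gloc_ext (xs h) (xs h') k t.+1).
  have ee' k : eloc f T Gamma (xs h) (Bs h) k t = eloc f T Gamma (xs h') (Bs h') k t.
    by rewrite /eloc BB' gg'.
  have dd' : \sum_(k < n | t \in T k) pad (eloc f T Gamma (xs h) (Bs h) k t) =
      \sum_(k < n | t \in T k) pad (eloc f T Gamma (xs h') (Bs h') k t).
    by apply: eq_bigr => k _; rewrite ee'.
  have zz' k : (F t h).2 k = (F t h').2 k by rewrite /F /= vv' rr' BB'.
  have yy' : (F t h).1 = (F t h').1.
    by apply: (f_equal2 +%R (xx' t (leqnn t))); apply: (congr1 ( *:%R (eps t)) dd').
  exact: (injective_projections _ _ yy' (functional_extensionality_dep zz')).
have [h [h0 hS]] := history_recursion (x0, B0) F_ext.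
exists (xs h), (Bs h); split=> [|t|k|k t].
- by rewrite /xs h0.
- by rewrite {1}/xs hS.
- by rewrite /Bs h0.
- by rewrite {1}/Bs hS.
Qed.

Variables (x0 : 'bV[R]_(n, p)) (B0 : forall k : 'I_n, 'bM[R]_(deg e k, p)).
Hypothesis gamma_gt0 : 0 < gamma.
Hypothesis Gamma_gt0 : 0 < Gamma.
Hypothesis B0_sym : forall k, (B0 k)^T = B0 k.
Hypothesis B0_ge : forall k, loewner_le gamma%:M (B0 k).
Hypothesis curv : curvature_condition f T gamma Gamma x0 B0.
Variables (eps : nat -> R) (x : nat -> 'bV[R]_(n, p)).
Variable Bk : forall k : 'I_n, nat -> 'bM[R]_(deg e k, p).
Hypothesis eps_gt0 : forall t, 0 < eps t.
Hypothesis run : dbfgs_run f T gamma Gamma x0 B0 eps x Bk.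

Lemma run_matrix_ge k t : (Bk k t)^T = Bk k t /\ loewner_le gamma%:M (Bk k t).
Proof.
have [_ _ Bk0 BkS] := run.
elim: t => [|t [sym ge]]; first by rewrite Bk0.
rewrite BkS; case: ifP => [/andP[tT v_neq0]|//].
split; first exact: bfgs_update_sym.
by apply: bfgs_update_ge => //; exact: (curv eps_gt0 run).
Qed.

Definition dir_bound : R := 2 * gamma^-1 ^+ 2 + 2 * Gamma ^+ 2.

Definition descent_rate : R := Gamma / n.+1%:R.

Lemma sq_eloc_le k t :
  sq (eloc f T Gamma x Bk k t) <= dir_bound * sq (gloc e f T x k t).
Proof.
have [_ ge] := run_matrix_ge k t.
rewrite /eloc sqN mulmxDl -scalemxAl; apply: (le_trans (sqD_le _ _)).
rewrite dotZl dotZr (mulrA Gamma Gamma) -expr2 /dir_bound [leRHS]mulrDl -!(mulrA 2).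
apply: lerD; apply: ler_wpM2l => //; first exact: invmx_sq_le gamma_gt0 ge _.
by apply: ler_wpM2l; rewrite ?sqr_ge0 ?Dloc_upper.
Qed.

(** The inverse matrix contributes with a favourable but possibly vanishing
amount; the decrease comes from the regularization alone. *)
Lemma dot_eloc_le k t :
  dot (gloc e f T x k t) (eloc f T Gamma x Bk k t)
    <= - (descent_rate * sq (gloc e f T x k t)).
Proof.
have [_ ge] := run_matrix_ge k t.
rewrite /eloc dotNr mulmxDl -scalemxAl dotDr dotZr lerN2 -[leLHS]add0r lerD //.
  exact: invmx_dot_ge0 gamma_gt0 ge _.
by rewrite /descent_rate -mulrA ler_wpM2l ?(ltW Gamma_gt0) ?Dloc_lower.
Qed.

End Runs.

(** * Descent with outdated gradients *)

Lemma sum_le_nat {R : realType} n (P : pred 'I_n) (F : 'I_n -> R) b :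
  (forall i, 0 <= F i <= b) -> \sum_(i < n | P i) F i <= n%:R * b.
Proof.
move=> Fb; rewrite big_mkcond mulr_natl -[n in b *+ n]card_ord -sumr_const.
apply: ler_sum => i _; have /andP[F_ge0 F_le] := Fb i.
by case: ifP => // _; apply: le_trans F_le.
Qed.

Section AsynchronousDescent.
Context {R : realType} {n p : nat}.
Variables (e : rel 'I_n) (f : 'bV[R]_(n, p) -> R) (T : 'I_n -> set nat).
Variables (L fmin a C eps : R) (M : nat).
Hypothesis f_ge : forall y, fmin <= f y.
Hypothesis f_upper : forall y z,
  f z <= f y + dot (grad f y) (z - y) + L / 2 * sq (z - y).
Hypothesis grad_lip : forall y z,
  sq (grad f z - grad f y) <= L ^+ 2 * sq (z - y).
Hypothesis delay_ge : forall i j t, (t <= delay T i j t + M)%N.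
Hypotheses (L_gt0 : 0 < L) (a_gt0 : 0 < a) (C_gt0 : 0 < C) (eps_gt0 : 0 < eps).

Variables (x : nat -> 'bV[R]_(n, p)).
Variable d : forall k : 'I_n, nat -> 'bV[R]_(deg e k, p).
Hypothesis x_step : forall t,
  x t.+1 = x t + eps *: \sum_(k < n | t \in T k) pad (d k t).
Hypothesis d_bound : forall k t, sq (d k t) <= C * sq (gloc e f T x k t).
Hypothesis d_descent : forall k t,
  dot (gloc e f T x k t) (d k t) <= - (a * sq (gloc e f T x k t)).

Local Notation g t := (grad f (x t)).
Local Notation ghat k t := (gloc e f T x k t).

(** The decrease of f that can be hoped for at time t, up to the factor
[eps * a]: only active nodes contribute, with their outdated gradients. *)
Definition activity t : R := \sum_(k < n | t \in T k) sq (ghat k t).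

Local Notation S := (psum activity).
Local Notation window m t := (S t - S (t - m)).

Lemma activity_ge0 t : 0 <= activity t.
Proof. by apply: sumr_ge0 => k _; exact: sq_ge0. Qed.

Let move_cst : R := n%:R * C.

Let move_cst_ge0 : 0 <= move_cst.
Proof. by rewrite mulr_ge0 // ltW. Qed.

Let dir t := \sum_(k < n | t \in T k) pad (d k t).

Lemma sq_dir_le t : sq (dir t) <= move_cst * activity t.
Proof.
have -> : move_cst = (size (index_enum 'I_n))%:R * C.
  by rewrite -sum1_size sum1_card card_ord.
apply: (le_trans (sq_sum_le _ _ _)); rewrite -mulrA ler_wpM2l //.
rewrite /activity mulr_sumr; apply: ler_sum => k _.
by rewrite sq_pad d_bound.
Qed.

Lemma sq_move_le m s t : (s <= t)%N -> (t <= s + m)%N ->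
  sq (x t - x s) <= m%:R * (eps ^+ 2 * move_cst) * window m t.
Proof.
move=> st tsm; rewrite -(telescope_sumr x st).
apply: (le_trans (sq_sum_le _ _ _)); rewrite size_iota.
apply: (@le_trans _ _ (m%:R * (eps ^+ 2 * move_cst * (S t - S s)))); last first.
  rewrite -[leRHS]mulrA; apply: ler_wpM2l => //; apply: ler_wpM2l.
    by rewrite mulr_ge0 ?sqr_ge0.
  rewrite lerD2l lerN2; apply: psum_homo; first exact: activity_ge0.
  by rewrite leq_subLR addnC.
apply: ler_pM => //.
- by apply: sumr_ge0 => r _; exact: sq_ge0.
- by rewrite ler_nat leq_subLR.
rewrite -psumB // mulr_sumr; apply: ler_sum => r _.
rewrite x_step [x r + _]addrC addrK dotZl dotZr mulrA -expr2 -mulrA.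
by rewrite ler_wpM2l ?sqr_ge0 ?sq_dir_le.
Qed.

Let lag_cst : R := n%:R * (L ^+ 2 * (M%:R * move_cst)).

Let lag_cst_ge0 : 0 <= lag_cst.
Proof. by rewrite mulr_ge0 // mulr_ge0 ?sqr_ge0 // mulr_ge0. Qed.

Lemma sq_lag_le k t :
  sq (restr e k (g t) - ghat k t) <= eps ^+ 2 * lag_cst * window M t.
Proof.
have -> : eps ^+ 2 * lag_cst * window M t =
    n%:R * (L ^+ 2 * (M%:R * (eps ^+ 2 * move_cst) * window M t)).
  by rewrite /lag_cst; ring.
rewrite /restr /gloc gatherB; apply: (le_trans (sq_gather_le _ _ _)).
apply: sum_le_nat => j; rewrite sq_ge0 -blkB /=.
apply: (le_trans (sq_blk_le _ _)); apply: (le_trans (grad_lip _ _)).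
rewrite ler_wpM2l ?sqr_ge0 // sq_move_le ?delay_ge //.
by rewrite (leq_trans (delay_le _ _ _ _)) ?leq_pred.
Qed.

Let own_cst : R := C / 2 + L / 2 * move_cst.
Let past_cst : R := n%:R * lag_cst / 2.

(** The linear decrease comes from pairing each direction with the outdated
gradient that produced it.  The cross term with the gradient lag is split
evenly by Young's inequality, and both halves are of order [eps ^+ 2] because
the lag is of order [eps]. *)
Lemma one_step_descent t :
  f (x t.+1) <= f (x t) - eps * a * activity t
    + eps ^+ 2 * (own_cst * activity t + past_cst * window M t).
Proof.
have := f_upper (x t) (x t.+1).
rewrite {2 3 4}x_step -/(dir t) [x t + _]addrC addrK dotZr dotZl dotZr.
have inner : eps * dot (g t) (dir t) <=
    - (eps * a * activity t) + eps ^+ 2 * (C / 2) * activity t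
    + eps ^+ 2 * past_cst * window M t.
  apply: (@le_trans _ _ (\sum_(k < n | t \in T k)
     ((eps ^+ 2 * (C / 2) - eps * a) * sq (ghat k t)
      + sq (restr e k (g t) - ghat k t) / 2))).
    rewrite /dir dot_sumr mulr_sumr; apply: ler_sum => k _; rewrite dot_pad.
    have := young1 (restr e k (g t) - ghat k t) (eps *: d k t).
    rewrite !dotZr dotZl dotDl dotNl.
    have : eps * dot (ghat k t) (d k t) <= - (eps * (a * sq (ghat k t))).
      by rewrite -mulrN ler_wpM2l ?(ltW eps_gt0).
    have : eps * (eps * sq (d k t)) <= eps * (eps * (C * sq (ghat k t))).
      by rewrite !ler_wpM2l ?(ltW eps_gt0).
    lra.
  rewrite big_split -mulr_sumr -/(activity t) -mulr_suml /=.
  have : \sum_(k < n | t \in T k) sq (restr e k (g t) - ghat k t)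
      <= n%:R * (eps ^+ 2 * lag_cst * window M t).
    by apply: sum_le_nat => k; rewrite sq_ge0 sq_lag_le.
  rewrite /past_cst; lra.
have : L / 2 * (eps * (eps * sq (dir t))) <=
    L / 2 * (eps * (eps * (move_cst * activity t))).
  by rewrite !ler_wpM2l ?sq_dir_le ?(ltW eps_gt0) // divr_ge0 // ltW.
rewrite /own_cst; lra.
Qed.

(** The coefficient of [eps ^+ 2] once the descent inequalities are summed: each
activity is charged once for its own step and at most M times for the lags it
causes later. *)
Definition penalty_cst : R := own_cst + past_cst * M%:R.

Lemma penalty_cst_gt0 : 0 < penalty_cst.
Proof.
rewrite /penalty_cst -addrA ltr_wpDr ?divr_gt0 // addr_ge0 //.
  by rewrite mulr_ge0 // divr_ge0 // ltW.
by rewrite mulr_ge0 // divr_ge0 // mulr_ge0 // lag_cst_ge0.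
Qed.

Hypothesis eps_small : eps * penalty_cst <= a / 2.

(** Half of the linear decrease pays for the second-order error; the other half
is bounded by the total decrease of f. *)
Lemma psum_activity_bounded N : eps * (a / 2) * S N <= f (x 0%N) - fmin.
Proof.
have tele : f (x N) <= f (x 0%N) - eps * a * S N
    + eps ^+ 2 * (own_cst * S N + past_cst * \sum_(0 <= t < N) window M t).
  elim: N => [|N IHN]; first by rewrite psum0 big_geq // !(mulr0, addr0, subr0).
  have := one_step_descent N; rewrite big_nat_recr //= psumS; lra.
have past_ge0 : 0 <= past_cst.
  by rewrite /past_cst divr_ge0 // mulr_ge0 // lag_cst_ge0.
have windows : past_cst * \sum_(0 <= t < N) window M t <= past_cst * (M%:R * S N).
  by rewrite ler_wpM2l // sum_window_le //; exact: activity_ge0.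
have S_ge0 : 0 <= S N by apply: psum_ge0; exact: activity_ge0.
have := f_ge (x N).
have : eps * (eps * (own_cst * S N + past_cst * \sum_(0 <= t < N) window M t))
    <= eps * (a / 2 * S N).
  rewrite ler_wpM2l ?(ltW eps_gt0) //.
  apply: (@le_trans _ _ (eps * penalty_cst * S N)); last by rewrite ler_wpM2r.
  rewrite -mulrA ler_wpM2l ?(ltW eps_gt0) // /penalty_cst; lra.
lra.
Qed.

Let grad_cst : R :=
  n%:R * (2 * (L ^+ 2 * ((M + M)%:R * (eps ^+ 2 * move_cst))) + 2).

(** Node k was last active at a time s at most M steps ago, using its own
gradient from a time r at most M steps earlier.  That gradient is part of the
activity at s, and it differs from the current one by the displacement of x
over 2M steps. *)
Lemma sq_grad_le t : (M < t)%N -> sq (g t) <= grad_cst * window (M + M) t.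
Proof.
move=> Mt; rewrite dot_blk /grad_cst -mulrA.
apply: sum_le_nat => k; rewrite sq_ge0 /=.
pose s := lastt T k t; pose r := delay T k k s.
have t_gt0 : (0 < t)%N by apply: leq_ltn_trans Mt.
have st : (s < t)%N by rewrite -(prednK t_gt0) ltnS lastt_le.
have tsM : (t <= s + M)%N.
  apply: (leq_trans (delay_ge k k t)); rewrite leq_add2r /delay.
  by apply: leq_trans (lastt_le _ _ _) _; exact: leq_pred.
have sT : s \in T k.
  by apply: lastt_in; rewrite -/s -(ltn_add2r M); apply: leq_trans tsM.
have rs : (r <= s)%N by rewrite (leq_trans (delay_le _ _ _ _)) ?leq_pred.
have trM : (t <= r + (M + M))%N.
  by apply: (leq_trans tsM); rewrite addnA leq_add2r delay_ge.
have old : sq (blk (g r) k) <= window (M + M) t.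
  apply: (@le_trans _ _ (sq (ghat k s))).
    exact: (sq_gather_self e k (fun j => blk (g (delay T k j s)) j)).
  apply: (@le_trans _ _ (activity s)).
    by rewrite /activity (bigD1 k) //= lerDl sumr_ge0 // => j _; exact: sq_ge0.
  have -> : activity s = S s.+1 - S s by rewrite psumS addrC addKr.
  apply: lerB; apply: psum_homo => //; try exact: activity_ge0.
  by rewrite leq_subLR addnC (leq_trans tsM) // leq_add2l leq_addr.
have new : sq (blk (g t) k - blk (g r) k) <=
    L ^+ 2 * ((M + M)%:R * (eps ^+ 2 * move_cst) * window (M + M) t).
  rewrite -blkB; apply: (le_trans (sq_blk_le _ _)); apply: (le_trans (grad_lip _ _)).
  by rewrite ler_wpM2l ?sqr_ge0 // sq_move_le // (leq_trans rs) // ltnW.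
have := sqD_le (blk (g t) k - blk (g r) k) (blk (g r) k); rewrite subrK; lra.
Qed.

Lemma async_grad_cvg0 : grad f (x t) @[t --> \oo] --> (0 : 'bV[R]_(n, p)).
Proof.
have sq_cvg : sq (g t) @[t --> \oo] --> (0 : R).
  apply: (@squeeze_cvgr _ _ _ _ (cst 0) (fun t => grad_cst * window (M + M) t)).
  - exists M.+1 => // t /= Mt; by rewrite sq_ge0 sq_grad_le.
  - exact: cvg_cst.
  rewrite -[0](mulr0 grad_cst); apply: cvgMr.
  apply: (@window_cvg0 _ _ activity_ge0 _ ((eps * (a / 2))^-1 * (f (x 0%N) - fmin))) => N.
  by rewrite ler_pdivlMl ?psum_activity_bounded // !mulr_gt0 ?invr_gt0.
apply/cvgr0Pnorm_lt => eta eta_gt0.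
have eta2_gt0 : 0 < eta ^+ 2 by rewrite exprn_gt0.
have /cvgr0Pnorm_lt/(_ _ eta2_gt0) := sq_cvg.
apply: filterS => t; rewrite ger0_norm ?sq_ge0 // => sq_lt.
rewrite [`|_|]mx_normrE; apply/bigmax_ltP; split=> // -[i j] _ /=.
rewrite ord1 -(ltr_pXn2r (n := 2)) ?nnegrE ?(ltW eta_gt0) // real_normK ?num_real //.
by apply: le_lt_trans sq_lt; exact: sqr_coord_le.
Qed.

End AsynchronousDescent.

(** * Convergence *)

Theorem theorem3 (R : realType) (n p : nat) (e : rel 'I_n)
  (e_sym : symmetric e)
  (f : 'bV[R]_(n, p) -> R)
  (f_local : forall (i : 'I_n) (x y : 'bV[R]_(n, p)),
     restr e i x = restr e i y -> blk (grad f x) i = blk (grad f y) i)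
  (f_min : exists xstar, forall x, f xstar <= f x)
  (L : R) (L_gt0 : 0 < L)
  (f_diff2 : twice_differentiable f)
  (f_hess : forall x, loewner_le 0 (hess f x) /\ loewner_le (hess f x) L%:M)
  (T : 'I_n -> set nat)
  (gamma Gamma : R) (gamma_gt0 : 0 < gamma) (Gamma_gt0 : 0 < Gamma)
  (x0 : 'bV[R]_(n, p))
  (B0 : forall k : 'I_n, 'bM[R]_(deg e k, p))
  (B0_sym : forall k, (B0 k)^T = B0 k)
  (B0_ge : forall k, loewner_le gamma%:M (B0 k))
  (curv : curvature_condition f T gamma Gamma x0 B0)
  (B : R) (B_gt0 : 0 < B) (async : partially_asynchronous T B) :
  exists eps : nat -> R,
    [/\ forall t, 0 < eps t,
        exists x Bk, dbfgs_run f T gamma Gamma x0 B0 eps x Bk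
      & forall x Bk, dbfgs_run f T gamma Gamma x0 B0 eps x Bk ->
          grad f (x t) @[t --> \oo] --> (0 : 'bV[R]_(n, p))].
Proof.
have [xstar f_ge] := f_min.
have [M delay_ge] := delay_bounded async.
pose a := @descent_rate R n Gamma; pose C := dir_bound gamma Gamma.
have a_gt0 : 0 < a by rewrite divr_gt0.
have C_gt0 : 0 < C.
  by rewrite addr_gt0 // mulr_gt0 // exprn_gt0 // invr_gt0.
have K_gt0 := @penalty_cst_gt0 R n L C M L_gt0 C_gt0.
(* The largest constant stepsize whose second-order error takes up at most half
   of the decrease. *)
pose eps := a / 2 / @penalty_cst R n L C M.
have eps_gt0 : 0 < eps by rewrite !divr_gt0.
exists (fun=> eps); split=> [//||x Bk run]; first exact: dbfgs_run_exists.
have [_ x_step _ _] := run.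
have f_upper y z := (first_order_bounds f_diff2 f_hess y z).2.
have eps_pos (t : nat) : 0 < eps by [].
apply: (async_grad_cvg0 f_ge f_upper (grad_lipschitz f_diff2 f_hess L_gt0)
  delay_ge L_gt0 a_gt0 C_gt0 eps_gt0 x_step).
- exact: (sq_eloc_le gamma_gt0 B0_sym B0_ge curv eps_pos run).
- exact: (dot_eloc_le gamma_gt0 Gamma_gt0 B0_sym B0_ge curv eps_pos run).
- by rewrite /eps divfK // gt_eqF.
Qed.
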